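(* Any type $\mathfrak{C}$-group in $\mathrm{PGL}_3(\mathbb{C})$ is pseudo-real, except $\langle T\rangle$ and $\mathcal{G}_{12}$. Similarly, any type $\mathfrak{D}$-group in $\mathrm{PGL}_3(\mathbb{C})$ is pseudo-real, except $\langle T,R\rangle$ and $\mathcal{G}_{24}$.
   Context: Here $\zeta_n=e^{2\pi i/n}$, and $\sigma$ is complex conjugation, acting entrywise on $\mathrm{PGL}_3(\mathbb{C})$; for a subgroup $G$ put ${}^{\sigma}G=\{{}^{\sigma}g: g\in G\}$. A matrix in $\mathrm{GL}_3(\mathbb{C})$ is identified with its class in $\mathrm{PGL}_3(\mathbb{C})$. For linear forms $L_1,L_2,L_3$ in $X,Y,Z$, $[L_1:L_2:L_3]$ denotes the class of the matrix whose $i$-th row lists the coefficients of $L_i$. Put $T=[Y:Z:X]$ and $R=[X:Z:Y]$. A type $\mathfrak{C}$-group is a finite subgroup of $\mathrm{PGL}_3(\mathbb{C})$ generated by $T$ and finitely many diagonal elements of the form $\mathrm{diag}(1,\zeta_n^a,\zeta_n^b)$ for some $n,a,b$. A type $\mathfrak{D}$-group is a subgroup of $\mathrm{PGL}_3(\mathbb{C})$ generated by $R$ and a type $\mathfrak{C}$-group. $\mathcal{G}_{12}$ is the group generated by $T$, $\mathrm{diag}(1,-1,1)$ and $\mathrm{diag}(1,1,-1)$ (isomorphic to $\mathrm{A}_4$), and $\mathcal{G}_{24}$ is the group generated by $\mathcal{G}_{12}$ and $R$ (isomorphic to $\mathrm{S}_4$). For a finite subgroup $G\subset\mathrm{PGL}_3(\mathbb{C})$: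 $G$ has a real field of moduli if ${}^{\sigma}G$ and $G$ are conjugate in $\mathrm{PGL}_3(\mathbb{C})$; $G$ is definable over $\mathbb{R}$ if it is $\mathrm{PGL}_3(\mathbb{C})$-conjugate to some $G'\subset\mathrm{PGL}_3(\mathbb{R})$; $G$ is pseudo-real if it has a real field of moduli but is not definable over $\mathbb{R}$. *)

(* Defs.v *)
From HB Require Import structures.
From mathcomp Require Import all_boot all_order all_algebra.
From mathcomp Require Import generic_quotient.
From mathcomp Require Import boolp classical_sets functions cardinality.
From mathcomp Require Import reals trigo.
From mathcomp Require Import complex.

Set Implicit Arguments.
Unset Strict Implicit.
Unset Printing Implicit Defensive.

Import Order.TTheory GRing.Theory Num.Theory.

Local Open Scope classical_set_scope.
Local Open Scope ring_scope.
Local Open Scope quotient_scope.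

(* The library's {unit R} is restricted to finite rings, so the (infinite) groups
   GL_n(F) and PGL_n(F) = GL_n(F) / F^* are built here. *)

Section GL.
Variables (F : fieldType) (n : nat).

Inductive GL := MkGL (A : 'M[F]_n) of A \in unitmx.
Definition GLmx (g : GL) := let: MkGL A _ := g in A.

HB.instance Definition _ := [isSub for GLmx].
HB.instance Definition _ := [Choice of GL by <:].

Implicit Types g h : GL.

Fact GL_one_subproof : (1%:M : 'M[F]_n) \in unitmx.
Proof. exact: unitmx1. Qed.
Fact GL_mul_subproof g h : GLmx g *m GLmx h \in unitmx.
Proof. by rewrite unitmx_mul (valP g) (valP h). Qed.
Fact GL_inv_subproof g : invmx (GLmx g) \in unitmx.
Proof. by rewrite unitmx_inv (valP g). Qed.

Definition GL_one := MkGL GL_one_subproof.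
Definition GL_mul g h := MkGL (GL_mul_subproof g h).
Definition GL_inv g := MkGL (GL_inv_subproof g).

Fact GL_mulA : associative GL_mul.
Proof. by move=> f g h; apply: val_inj; rewrite /= mulmxA. Qed.
Fact GL_mul1 : left_id GL_one GL_mul.
Proof. by move=> g; apply: val_inj; rewrite /= mul1mx. Qed.
Fact GL_mulr1 : right_id GL_one GL_mul.
Proof. by move=> g; apply: val_inj; rewrite /= mulmx1. Qed.
Fact GL_mulV : left_inverse GL_one GL_inv GL_mul.
Proof. by move=> g; apply: val_inj; rewrite /= mulVmx ?(valP g). Qed.
Fact GL_mulrV : right_inverse GL_one GL_inv GL_mul.
Proof. by move=> g; apply: val_inj; rewrite /= mulmxV ?(valP g). Qed.

HB.instance Definition _ :=
  isGroup.Build GL GL_mulA GL_mul1 GL_mulr1 GL_mulV GL_mulrV.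

Definition proportional : rel GL :=
  fun g h => `[< exists2 c : F, c != 0 & GLmx g = c *: GLmx h >].

Fact proportional_refl : reflexive proportional.
Proof. by move=> g; apply/asboolP; exists 1; rewrite ?oner_eq0 ?scale1r. Qed.
Fact proportional_sym : symmetric proportional.
Proof.
suff H g h : proportional g h -> proportional h g.
  by move=> g h; apply/idP/idP; exact: H.
move=> /asboolP[c c0 e]; apply/asboolP; exists c^-1; first by rewrite invr_eq0.
by rewrite e scalerA mulVf ?scale1r.
Qed.
Fact proportional_trans : transitive proportional.
Proof.
move=> g f h /asboolP[c c0 e1] /asboolP[d d0 e2]; apply/asboolP.
by exists (c * d); rewrite ?mulf_neq0 // e1 e2 scalerA.
Qed.

Canonical proportional_equiv :=
  EquivRel proportional proportional_refl proportional_sym proportional_trans.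

Definition PGL := {eq_quot proportional}.
HB.instance Definition _ := Choice.on PGL.
HB.instance Definition _ := EqQuotient.on PGL.

Definition PGL_one : PGL := lift_cst PGL (1%g : GL).
Definition PGL_mul : PGL -> PGL -> PGL := lift_op2 PGL (fun g h : GL => (g * h)%g).
Definition PGL_inv : PGL -> PGL := lift_op1 PGL (fun g : GL => (g^-1)%g).

Fact pi_PGL_mul : {morph \pi_PGL : g h / (g * h)%g >-> PGL_mul g h}.
Proof.
move=> g h; unlock PGL_mul; apply/eqmodP/asboolP.
have /eqmodP/asboolP[c c0 e1] : (repr (\pi_PGL g)) = g %[mod PGL] by rewrite reprK.
have /eqmodP/asboolP[d d0 e2] : (repr (\pi_PGL h)) = h %[mod PGL] by rewrite reprK.
exists (c * d)^-1; first by rewrite invr_eq0 mulf_neq0.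
rewrite /= e1 e2 -scalemxAl -scalemxAr !scalerA -mulrA mulVf ?scale1r //.
by rewrite mulf_neq0.
Qed.

Fact pi_PGL_inv : {morph \pi_PGL : g / (g^-1)%g >-> PGL_inv g}.
Proof.
move=> g; unlock PGL_inv; apply/eqmodP/asboolP.
have /eqmodP/asboolP[c c0 e1] : (repr (\pi_PGL g)) = g %[mod PGL] by rewrite reprK.
exists c => //=; rewrite e1 invmxZ ?unitfE ?scalerA ?mulfV ?scale1r //.
by rewrite -e1; exact: valP.
Qed.

Canonical PGL_mul_morph := PiMorph2 pi_PGL_mul.
Canonical PGL_inv_morph := PiMorph1 pi_PGL_inv.
Canonical PGL_one_morph := PiConst PGL_one.

Fact PGL_mulA : associative PGL_mul.
Proof. by elim/quotW=> f; elim/quotW=> g; elim/quotW=> h; rewrite !piE mulgA. Qed.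
Fact PGL_mul1 : left_id PGL_one PGL_mul.
Proof. by elim/quotW=> f; rewrite !piE mul1g. Qed.
Fact PGL_mulr1 : right_id PGL_one PGL_mul.
Proof. by elim/quotW=> f; rewrite !piE mulg1. Qed.
Fact PGL_mulV : left_inverse PGL_one PGL_inv PGL_mul.
Proof. by elim/quotW=> f; rewrite !piE mulVg. Qed.
Fact PGL_mulrV : right_inverse PGL_one PGL_inv PGL_mul.
Proof. by elim/quotW=> f; rewrite !piE mulgV. Qed.

HB.instance Definition _ :=
  isGroup.Build PGL PGL_mulA PGL_mul1 PGL_mulr1 PGL_mulV PGL_mulrV.

(* The class of A; only meaningful for invertible A, singular matrices being
   sent to 1. *)
Definition pgl (A : 'M[F]_n) : PGL := \pi_PGL (insubd (1%g : GL) A).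

Lemma pglE (A : 'M[F]_n) (uA : A \in unitmx) : pgl A = \pi_PGL (MkGL uA).
Proof. by congr (\pi_PGL _); apply: val_inj; rewrite insubdK. Qed.

Lemma pgl_eq (A B : 'M[F]_n) : A \in unitmx -> B \in unitmx ->
  pgl A = pgl B <-> exists2 c : F, c != 0 & A = c *: B.
Proof.
move=> uA uB; rewrite !pglE.
by split=> [/eqmodP/asboolP|?] //; apply/eqmodP/asboolP.
Qed.

Lemma pglM (A B : 'M[F]_n) : A \in unitmx -> B \in unitmx ->
  pgl (A *m B) = (pgl A * pgl B)%g.
Proof.
move=> uA uB; have uAB : A *m B \in unitmx by rewrite unitmx_mul uA.
by rewrite !pglE [RHS](esym (pi_PGL_mul _ _)); congr (\pi_PGL _); apply: val_inj.
Qed.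

End GL.

Section Map.
Variables (F L : fieldType) (f : {rmorphism F -> L}) (n : nat).

Fact GL_map_subproof (g : GL F n) : map_mx f (GLmx g) \in unitmx.
Proof. by rewrite map_unitmx (valP g). Qed.

Definition GL_map (g : GL F n) : GL L n := MkGL (GL_map_subproof g).
Definition PGL_map : PGL F n -> PGL L n := lift_op11 (PGL F n) (PGL L n) GL_map.

Lemma pi_PGL_map (g : GL F n) :
  PGL_map (\pi_(PGL F n) g) = \pi_(PGL L n) (GL_map g).
Proof.
unlock PGL_map; apply/eqmodP/asboolP.
have /eqmodP/asboolP[c c0 e] : repr (\pi_(PGL F n) g) = g %[mod PGL F n].
  by rewrite reprK.
by exists (f c); rewrite ?fmorph_eq0 //= e map_mxZ.
Qed.

Lemma PGL_map_pgl (A : 'M[F]_n) : A \in unitmx ->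
  PGL_map (pgl A) = pgl (map_mx f A).
Proof.
move=> uA; have ufA : map_mx f A \in unitmx by rewrite map_unitmx.
by rewrite !pglE pi_PGL_map; congr (\pi_(PGL L n) _); apply: val_inj.
Qed.

End Map.

Arguments PGL_map {F L} f {n}.

Section Subgroups.
Variable gT : groupType.
Implicit Types S G H : set gT.

Definition is_subgroup G : Prop := group_closed [in G].

Definition generated S : set gT := smallest is_subgroup S.

Definition conj_set G (h : gT) : set gT := [set (g ^ h)%g | g in G].

Definition conjugate G H : Prop := exists h : gT, conj_set G h = H.

End Subgroups.

Section Moduli.
(* R : realType is the field of real numbers and R[i] that of complex numbers. *)
Variable R : realType.
Notation PGL3C := (PGL R[i] 3).
Implicit Types G H : set PGL3C.

Definition sigma : PGL3C -> PGL3C := PGL_map conjc.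

(* PGL_3(R) is seen inside PGL_3(C) as the image of the map induced by the
   inclusion of R in R[i]. *)
Definition PGL3R : set PGL3C := range (PGL_map (real_complex R)).

Definition real_field_of_moduli G : Prop := conjugate (sigma @` G) G.

Definition definable_over_R G : Prop :=
  exists2 G' : set PGL3C, is_subgroup G' /\ G' `<=` PGL3R & conjugate G G'.

Definition pseudo_real G : Prop :=
  real_field_of_moduli G /\ ~ definable_over_R G.

(* exp(2 i pi / n), meaningful for 0 < n *)
Definition zeta (n : nat) : R[i] :=
  (cos (2 * pi / n%:R) +i* sin (2 * pi / n%:R))%C.

Lemma zeta_neq0 n : zeta n != 0.
Proof.
apply/eqP => /eqP; rewrite eq_complex /= => /andP[/eqP c0 /eqP s0].
by have := cos2Dsin2 (2 * pi / n%:R : R);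
  rewrite c0 s0 expr0n addr0 => /esym/eqP; rewrite oner_eq0.
Qed.

(* A linear form is the row of its coefficients on X, Y, Z, so that forms_mx
   L1 L2 L3 represents [L1:L2:L3]. *)
Definition linX : 'rV[R[i]]_3 := delta_mx 0 0.
Definition linY : 'rV[R[i]]_3 := delta_mx 0 1.
Definition linZ : 'rV[R[i]]_3 := delta_mx 0 2%:R.

Definition forms_mx (L1 L2 L3 : 'rV[R[i]]_3) : 'M[R[i]]_3 :=
  \matrix_(i < 3) [:: L1; L2; L3]`_i.
Definition diag3_mx (a b c : R[i]) : 'M[R[i]]_3 :=
  diag_mx (\row_(i < 3) [:: a; b; c]`_i).

Definition elT : PGL3C := pgl (forms_mx linY linZ linX).
Definition elR : PGL3C := pgl (forms_mx linX linZ linY).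
Definition diag3 (a b c : R[i]) : PGL3C := pgl (diag3_mx a b c).

(* The matrices above are invertible, so pgl takes no junk value on them. *)
Lemma T_unit : forms_mx linY linZ linX \in unitmx.
Proof.
suff /mulmx1_unit[] : forms_mx linY linZ linX *m
  (forms_mx linY linZ linX)^T = 1%:M by [].
apply/matrixP=> i j; rewrite !mxE !big_ord_recl big_ord0 !mxE.
case: i => [[|[|[|//]]] ?]; case: j => [[|[|[|//]]] ?];
  by rewrite /= !mxE /= !(mulr0, mulr1, mul0r, addr0, add0r).
Qed.

Lemma R_unit : forms_mx linX linZ linY \in unitmx.
Proof.
suff /mulmx1_unit[] : forms_mx linX linZ linY *m
  forms_mx linX linZ linY = 1%:M by [].
apply/matrixP=> i j; rewrite !mxE !big_ord_recl big_ord0 !mxE.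
case: i => [[|[|[|//]]] ?]; case: j => [[|[|[|//]]] ?];
  by rewrite /= !mxE /= !(mulr0, mulr1, mul0r, addr0, add0r).
Qed.

Lemma diag3_unit a b c : a != 0 -> b != 0 -> c != 0 ->
  diag3_mx a b c \in unitmx.
Proof.
move=> a0 b0 c0; rewrite unitmxE det_diag unitfE !big_ord_recl big_ord0 !mxE /=.
by rewrite mulr1 !mulf_neq0.
Qed.

Definition root_diag : set PGL3C :=
  [set d | exists (n : nat) (a b : int),
     (0 < n)%N /\ d = diag3 1 (zeta n ^ a) (zeta n ^ b)].

Definition typeC G : Prop :=
  finite_set G /\
  exists D : set PGL3C,
    [/\ finite_set D, D `<=` root_diag & G = generated (elT |` D)].

Definition typeD G : Prop := exists2 H, typeC H & G = generated (elR |` H).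

Definition G12 : set PGL3C :=
  generated [set elT; diag3 1 (-1) 1; diag3 1 1 (-1)].

Definition G24 : set PGL3C := generated (elR |` G12).

End Moduli.

Arguments PGL3R R : clear implicits.
Arguments G12 R : clear implicits.
Arguments G24 R : clear implicits.

(* Main.v *)
Require Import Defs.
From mathcomp Require Import all_boot all_order all_algebra.
From mathcomp Require Import generic_quotient boolp classical_sets reals trigo.
From mathcomp Require Import complex ring.

(** Complex conjugation fixes T and R and inverts the diagonal generators, so it
    maps every group of type C or D onto itself: the field of moduli is always
    real, and only definability over the reals is at stake.

    Let G be a group of type C that becomes real in some basis. The elements of
    PGL_3 lift to matrices only up to a scalar, so one looks for conditions
    insensitive to scaling. Two of them suffice.

    - The number tr^3/det of a matrix does not change under conjugation and
      scaling, hence is real on G (descends_in_trace). For diag(p,q,r) with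
      |p| = |q| = |r| = 1, the conjugates of p, q, r are their inverses, and with
      e1, e2, e3 the elementary symmetric functions the reality condition reads
      e1^3 e3 = e2^3. Since e1^3 e3 - e2^3 = (p^2-qr)(q^2-pr)(r^2-pq), one of the
      three entries has a square equal to the product of the other two
      (unit_circle_relation).

    - If A B = w B A holds for matrices lifting two elements of G, then w is real
      (descends_in_commutator).

    Conjugation by T permutes the diagonal entries cyclically, so for
    d = diag(1,a,b) in G the group also contains d modulo its conjugate by T.
    The first condition for both elements forces d^2 = diag(1,w,w^2) with
    w = a^2 and w^3 = 1. The commutator of T and this d^2 is the scalar w, so the
    second condition gives w = 1. All diagonal generators thus have entries 1 and
    -1; if all are trivial then G is generated by T, and otherwise the
    T-conjugates of a nontrivial one show that G is G12 (real_typeC).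

    A group of type D that becomes real in some basis contains a group H of
    type C that does so too, and it is generated by R and H with H one of the two
    groups just found. Conversely the exceptional groups are generated by real
    matrices. *)

Set Implicit Arguments.
Unset Strict Implicit.
Unset Printing Implicit Defensive.

Import Order.TTheory GRing.Theory Num.Theory.
Local Open Scope classical_set_scope.
Local Open Scope ring_scope.
Local Open Scope quotient_scope.

(** * Subgroups and generated subgroups *)

Section Generated.
Variable gT : groupType.
Implicit Types (S G H : set gT) (f : gT -> gT).

Lemma is_subgroupP G :
  is_subgroup G <-> G 1%g /\ (forall x y, G x -> G y -> G (x / y)%g).
Proof.
split=> -[G1 GB]; split; rewrite ?inE// in G1 *.
- by move=> x y Gx Gy; have:= GB x y; rewrite !inE; apply.
- by move=> x y; rewrite !inE; apply: GB.
Qed.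

Lemma subgroup1 G : is_subgroup G -> G 1%g.
Proof. by case/is_subgroupP. Qed.

Lemma subgroupV G x : is_subgroup G -> G x -> G (x^-1)%g.
Proof.
by case/is_subgroupP=> G1 GB Gx; rewrite -[(_^-1)%g]mul1g; apply: GB.
Qed.

Lemma subgroupM G x y : is_subgroup G -> G x -> G y -> G (x * y)%g.
Proof.
move=> gG Gx Gy; have [_ GB] := (is_subgroupP G).1 gG.
by rewrite -[y]invgK; apply: GB => //; apply: subgroupV.
Qed.

Lemma generated_group S : is_subgroup (generated S).
Proof.
apply/is_subgroupP; split=> [H [/subgroup1] //|x y Sx Sy H HS].
by have [/is_subgroupP[_ HB] _] := HS; apply: HB; [apply: Sx|apply: Sy].
Qed.

Lemma sub_generated S : S `<=` generated S.
Proof. exact: sub_smallest. Qed.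

Lemma generated_sub S G : is_subgroup G -> S `<=` G -> generated S `<=` G.
Proof. exact: smallest_sub. Qed.

Lemma generated_eq S1 S2 :
  S1 `<=` generated S2 -> S2 `<=` generated S1 -> generated S1 = generated S2.
Proof.
by move=> s12 s21; apply/seteqP; split; apply: generated_sub;
  first [exact: generated_group | assumption].
Qed.

Lemma generatedU_generated S1 S2 :
  generated (S1 `|` generated S2) = generated (S1 `|` S2).
Proof.
apply: generated_eq => x [Sx|Sx].
- by apply: sub_generated; left.
- apply: generated_sub Sx; first exact: generated_group.
  by move=> y Sy; apply: sub_generated; right.
- by apply: sub_generated; left.
- by apply: sub_generated; right; apply: sub_generated.
Qed.

Lemma preimage_group f G : {morph f : x y / (x * y)%g} ->
  is_subgroup G -> is_subgroup (f @^-1` G).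
Proof.
move=> fM gG; have f1 : f 1%g = 1%g.
  by apply: (mulIg (f 1%g)); rewrite -fM !mul1g.
have fV x : f (x^-1)%g = (f x)^-1%g.
  by apply: (mulIg (f x)); rewrite -fM !mulVg.
apply/is_subgroupP; rewrite /= f1; split=> [|x y Gx Gy]; first exact: subgroup1.
by rewrite fM fV; apply: subgroupM => //; apply: subgroupV.
Qed.

(** For an involution one inclusion is enough: applying [f] to it yields the other. *)
Lemma image_generated f S : {morph f : x y / (x * y)%g} -> involutive f ->
  f @` S `<=` generated S -> f @` generated S = generated S.
Proof.
move=> fM fK fS.
have sub : generated S `<=` f @^-1` generated S.
  apply: generated_sub; last by move=> x Sx; apply: fS; exists x.
  exact: preimage_group (generated_group S).
apply/seteqP; split=> [_ [x Sx <-]|x Sx]; first exact: sub.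
by exists (f x); [apply: sub|apply: fK].
Qed.

Lemma conjugate_refl G : conjugate G G.
Proof.
exists 1%g; apply/seteqP; split=> [_ [x Gx <-]|x Gx]; first by rewrite conjg1.
by exists x; rewrite ?conjg1.
Qed.

End Generated.

(** * Matrices that become defined over a subfield *)

Section Descent.
Variables (F L : fieldType) (f : {rmorphism F -> L}) (n : nat).
Implicit Types (A B H : 'M[L]_n.+1) (w : L).

Lemma pgl_surj (g : PGL L n.+1) : exists2 A, A \in unitmx & g = pgl A.
Proof.
by elim/quotW: g => -[A uA]; exists A => //; rewrite pglE.
Qed.

Lemma pgl1 : pgl 1%:M = 1%g :> PGL L n.+1.
Proof.
by apply: (mulgI (pgl 1%:M)); rewrite -pglM ?unitmx1// mulmx1 mulg1.
Qed.

(** The class of [A] in PGL comes from PGL over [F] after the change of basis [H];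
    the factor [c] accounts for the choice of the representative [A]. *)
Definition descends_in H A : Prop :=
  exists c, exists2 M : 'M[F]_n.+1, M \in unitmx &
    c != 0 /\ A *m H = c *: (H *m map_mx f M).

(** With the size of the matrix as exponent, the quotient of that power of the trace
    by the determinant is invariant under conjugation and homogeneous of degree 0, so it can be computed on the
    matrix over [F]. *)
Lemma descends_in_trace H A : H \in unitmx -> descends_in H A ->
  exists x, \tr A ^+ n.+1 = f x * \det A.
Proof.
move=> uH [c [M uM [c0 AH]]].
have -> : A = c *: (H *m map_mx f M *m invmx H).
  by rewrite scalemxAl -AH mulmxK.
exists (\tr M ^+ n.+1 / \det M).
rewrite linearZ /= mxtrace_mulC mulmxA mulVmx// mul1mx detZ !det_mulmx det_inv.
rewrite [_ * _ / \det H]mulrAC mulfV -?unitfE -?unitmxE// mul1r.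
rewrite trace_map_mx det_map_mx mulrCA -rmorphM mulfVK -?unitfE -?unitmxE//.
by rewrite rmorphXn -exprMn.
Qed.

(** The unknown scale factors of [A] and [B] cancel in a commutator. *)
Lemma descends_in_commutator H A B w : H \in unitmx ->
  descends_in H A -> descends_in H B -> A *m B = w *: (B *m A) ->
  exists x, w = f x.
Proof.
move=> uH [c [M uM [c0 AH]]] [d [N uN [d0 BH]]] comAB.
have AB : A *m B *m H = (c * d) *: (H *m map_mx f (M *m N)).
  by rewrite -mulmxA BH -scalemxAr mulmxA AH -scalemxAl scalerA mulrC map_mxM mulmxA.
have BA : B *m A *m H = (c * d) *: (H *m map_mx f (N *m M)).
  by rewrite -mulmxA AH -scalemxAr mulmxA BH -scalemxAl scalerA map_mxM mulmxA.
have MN : map_mx f (M *m N) = w *: map_mx f (N *m M).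
  apply: (can_inj (mulKmx uH)); apply: (scalerI (mulf_neq0 c0 d0)).
  by rewrite -AB comAB -scalemxAl BA -scalemxAr !scalerA mulrC.
exists ((M *m N *m invmx (N *m M)) 0 0).
transitivity ((map_mx f (M *m N *m invmx (N *m M))) 0 0); last by rewrite mxE.
rewrite map_mxM MN -scalemxAl -map_mxM mulmxV ?unitmx_mul ?uN//.
by rewrite map_mx1 scalemx1 mxE eqxx mulr1n.
Qed.

End Descent.

Lemma PGL_mapM (F L : fieldType) (f : {rmorphism F -> L}) n :
  {morph @PGL_map F L f n.+1 : x y / (x * y)%g}.
Proof.
move=> x y; have [A uA ->] := pgl_surj x; have [B uB ->] := pgl_surj y.
by rewrite -pglM// !PGL_map_pgl ?unitmx_mul ?uA// map_mxM pglM ?map_unitmx.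
Qed.

Lemma PGL_conj_descends (F L : fieldType) (f : {rmorphism F -> L}) n
    (H A : 'M[L]_n.+1) :
  H \in unitmx -> A \in unitmx -> range (PGL_map f) (pgl A ^ pgl H)%g ->
  descends_in f H A.
Proof.
move=> uH uA [x _]; have [M uM ->] := pgl_surj x; rewrite PGL_map_pgl// conjgE.
have uM' : map_mx f M \in unitmx by rewrite map_unitmx.
move=> /(congr1 (fun g => pgl H * g)%g).
rewrite mulVKg -!pglM// => /esym/pgl_eq[]; rewrite ?unitmx_mul ?uA ?uH//.
by move=> c c0 e; exists c, M.
Qed.

(** * Equations between the diagonal entries *)

(** Here [f] plays the role of complex conjugation. Applying it to the hypothesis
    and eliminating [x] gives e1^3 e3 = e2^3, and
    e1^3 e3 - e2^3 = (p^2 - q r) (q^2 - p r) (r^2 - p q). *)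
Lemma unit_circle_relation (K : idomainType) (f : {rmorphism K -> K}) p q r x :
  f p * p = 1 -> f q * q = 1 -> f r * r = 1 -> f x = x ->
  (p + q + r) ^+ 3 = x * (p * q * r) ->
  [\/ p ^+ 2 = q * r, q ^+ 2 = p * r | r ^+ 2 = p * q].
Proof.
move=> p1 q1 r1 fx e.
have e' : (f p + f q + f r) ^+ 3 = x * (f p * f q * f r).
  by have := congr1 f e; rewrite rmorphXn !rmorphD !rmorphM fx.
have {fx x e e'} e : (p + q + r) ^+ 3 * (f p * f q * f r)
    = (f p + f q + f r) ^+ 3 * (p * q * r).
  by rewrite e e' mulrAC.
move: (f p) (f q) (f r) p1 q1 r1 e => p' q' r' p1 q1 r1 e.
have /eqP : (p ^+ 2 - q * r) * (q ^+ 2 - p * r) * (r ^+ 2 - p * q) = 0.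
  transitivity ((p + q + r) ^+ 3 * (p' * q' * r') * (p * q * r) ^+ 2
    - (p' + q' + r') ^+ 3 * (p * q * r) * (p * q * r) ^+ 2); last first.
    by rewrite e subrr.
  by ring: p1 q1 r1.
rewrite !mulf_eq0 !subr_eq0 -orbA => /or3P[]/eqP ?.
- exact: Or31.
- exact: Or32.
- exact: Or33.
Qed.

(** The two assumptions amount to the relations of [unit_circle_relation] for the triples
    (1, a, b) and (b, a^2, a b^2); the conclusion says that the square of
    diag(1,a,b) is diag(1,w,w^2) for a cube root of unity w. *)
Lemma sixth_roots (F : fieldType) (a b : F) : a != 0 -> b != 0 ->
  [\/ 1 = a * b, a ^+ 2 = b | b ^+ 2 = a] ->
  [\/ a ^+ 3 = 1, a ^+ 3 = b ^+ 3 | b ^+ 3 = 1] ->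
  (a ^+ 2) ^+ 3 = 1 /\ b ^+ 2 = (a ^+ 2) ^+ 2.
Proof.
move=> a0 b0 e cubes.
have powX (x : F) : (x ^+ 2) ^+ 3 = (x ^+ 3) ^+ 2 by ring.
case: e => e.
- have b3 : b ^+ 3 * a ^+ 3 = 1 by rewrite mulrC -exprMn -e expr1n.
  have a6 : (a ^+ 3) ^+ 2 = 1.
    case: cubes => [->|a3b3|b31]; first by rewrite expr1n.
    + by rewrite expr2 {1}a3b3.
    + by move: b3; rewrite b31 mul1r => ->; rewrite expr1n.
  split; first by rewrite powX.
  transitivity ((a ^+ 3) ^+ 2 * b ^+ 2); first by rewrite a6 mul1r.
  by transitivity ((a * b) ^+ 2 * (a ^+ 2) ^+ 2); [ring|rewrite -e expr1n mul1r].
- rewrite -e; split=> //; rewrite powX.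
  have [->|a3b3|b3] := cubes; [by rewrite expr1n| |by rewrite -powX e].
  suff -> : a ^+ 3 = 1 by rewrite expr1n.
  by apply: (mulfI (expf_neq0 3 a0)); rewrite mulr1 -expr2 -powX e.
- have b6 : (b ^+ 3) ^+ 2 = 1.
    have [a3|a3b3|->] := cubes; [by rewrite -powX e| |by rewrite expr1n].
    suff -> : b ^+ 3 = 1 by rewrite expr1n.
    by apply: (mulfI (expf_neq0 3 b0)); rewrite mulr1 -expr2 -powX e.
  rewrite -e; split; first by rewrite [X in X ^+ 3]expr2 exprMn powX b6 mulr1.
  by transitivity ((b ^+ 3) ^+ 2 * b ^+ 2); [rewrite b6 mul1r|ring].
Qed.

(** * The elements T, R and diag(a,b,c) *)

Section PGL3.
Variable R : realType.
Local Notation C := R[i].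
Local Notation T := (elT R).
Local Notation mxT := (forms_mx (linY R) (linZ R) (linX R)).
Local Notation mxR := (forms_mx (linX R) (linZ R) (linY R)).
Implicit Types (a b c p q r x y z w : C) (d : PGL C 3) (G : set (PGL C 3)).

Lemma sigmaM : {morph @sigma R : x y / (x * y)%g}.
Proof. exact: PGL_mapM. Qed.

Lemma sigmaK : involutive (@sigma R).
Proof.
move=> x; have [A uA ->] := pgl_surj x; rewrite /sigma !PGL_map_pgl ?map_unitmx//.
by congr pgl; apply/matrixP=> i j; rewrite !mxE; exact: conjcK.
Qed.

Lemma PGL3R_group : is_subgroup (PGL3R R).
Proof.
apply/is_subgroupP; split.
  by exists (pgl 1%:M) => //; rewrite PGL_map_pgl ?unitmx1// map_mx1 pgl1.
move=> _ _ [x _ <-] [y _ <-]; exists (x / y)%g => //; rewrite PGL_mapM.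
congr (_ * _)%g; apply: (mulgI (PGL_map (real_complex R) y)).
rewrite -PGL_mapM !mulgV -pgl1 PGL_map_pgl ?unitmx1// map_mx1.
exact: pgl1.
Qed.

Lemma PGL3R_pgl (A : 'M[C]_3) : A \in unitmx -> map_mx conjc A = A ->
  PGL3R R (pgl A).
Proof.
move=> uA cA; have AE : A = map_mx (real_complex R) (map_mx (@complex.Re R) A).
  apply/matrixP=> i j; move/matrixP/(_ i j): cA; rewrite !mxE.
  case: (A i j) => x y [/eqP]; rewrite -subr_eq0 -opprD oppr_eq0 -mulr2n.
  by rewrite mulrn_eq0 /= => /eqP->.
have uB : map_mx (@complex.Re R) A \in unitmx.
  by rewrite -(map_unitmx (real_complex R)) -AE.
by exists (pgl (map_mx (@complex.Re R) A)) => //; rewrite PGL_map_pgl// -AE.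
Qed.

Lemma conj_forms_mx L1 L2 L3 : map_mx conjc L1 = L1 -> map_mx conjc L2 = L2 ->
  map_mx conjc L3 = L3 -> map_mx conjc (@forms_mx R L1 L2 L3) = forms_mx L1 L2 L3.
Proof.
move=> /matrixP e1 /matrixP e2 /matrixP e3; apply/matrixP=> i j.
have:= (e1 0 j, e2 0 j, e3 0 j); rewrite !mxE => -[[]].
by case: i => [[|[|[|//]]] ?] /=; rewrite ?mxE.
Qed.

Lemma conj_delta (j : 'I_3) : map_mx conjc (delta_mx 0 j : 'rV[C]_3) = delta_mx 0 j.
Proof. by rewrite map_delta_mx. Qed.

Lemma conj_mxT : map_mx conjc mxT = mxT.
Proof. exact: conj_forms_mx (conj_delta _) (conj_delta _) (conj_delta _). Qed.

Lemma conj_mxR : map_mx conjc mxR = mxR.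
Proof. exact: conj_forms_mx (conj_delta _) (conj_delta _) (conj_delta _). Qed.

Lemma conj_diag3 a b c :
  map_mx conjc (diag3_mx a b c) = diag3_mx (conjc a) (conjc b) (conjc c).
Proof.
rewrite map_diag_mx; congr diag_mx; apply/rowP => i; rewrite !mxE.
by case: i => [[|[|[|//]]] ?].
Qed.

Lemma diag3_mxM a b c a' b' c' :
  diag3_mx a b c *m diag3_mx a' b' c' = diag3_mx (a * a') (b * b') (c * c').
Proof.
rewrite mulmx_diag; congr diag_mx; apply/rowP => i; rewrite !mxE.
by case: i => [[|[|[|//]]] ?].
Qed.

Lemma diag3M a b c a' b' c' : a != 0 -> b != 0 -> c != 0 ->
  a' != 0 -> b' != 0 -> c' != 0 ->
  (diag3 a b c * diag3 a' b' c')%g = diag3 (a * a') (b * b') (c * c').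
Proof.
move=> a0 b0 c0 a0' b0' c0'.
have ud := diag3_unit a0 b0 c0; have ud' := diag3_unit a0' b0' c0'.
by rewrite /diag3 -(pglM ud ud') diag3_mxM.
Qed.

Lemma diag3_scale w a b c : w != 0 -> a != 0 -> b != 0 -> c != 0 ->
  diag3 (w * a) (w * b) (w * c) = diag3 a b c.
Proof.
move=> w0 a0 b0 c0; apply/pgl_eq; rewrite ?diag3_unit ?mulf_neq0//.
exists w => //; rewrite -linearZ; congr diag_mx; apply/rowP => i; rewrite !mxE.
by case: i => [[|[|[|//]]] ?].
Qed.

Lemma diag3_1 : diag3 1 1 1 = 1%g :> PGL C 3.
Proof.
rewrite -pgl1; congr pgl; rewrite -diag_const_mx; congr diag_mx.
by apply/rowP => i; rewrite !mxE; case: i => [[|[|[|//]]] ?].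
Qed.

Lemma mxT_diag3 a b c : mxT *m diag3_mx a b c = diag3_mx b c a *m mxT.
Proof.
rewrite mul_mx_diag mul_diag_mx; apply/matrixP => i j; rewrite !mxE.
case: i => [[|[|[|//]]] ?]; case: j => [[|[|[|//]]] ?];
  by rewrite /= !mxE /= ?(mulr0, mul0r, mulr1, mul1r).
Qed.

Lemma elT_diag3 a b c : a != 0 -> b != 0 -> c != 0 ->
  (T * diag3 a b c / T)%g = diag3 b c a.
Proof.
move=> a0 b0 c0; apply: (mulIg T); rewrite mulgVK.
have ud := diag3_unit a0 b0 c0; have ud' := diag3_unit b0 c0 a0.
by rewrite -(pglM (T_unit R) ud) -(pglM ud' (T_unit R)) mxT_diag3.
Qed.

Lemma diag3_shift G a b c : is_subgroup G -> G T ->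
  a != 0 -> b != 0 -> c != 0 -> G (diag3 a b c) -> G (diag3 b c a).
Proof.
move=> gG GT a0 b0 c0 Gd; rewrite -elT_diag3//.
by apply: subgroupM => //; [apply: subgroupM|apply: subgroupV].
Qed.

(** * Groups that are real in some basis *)

(** Unlike definability over the reals, this passes to subsets of [G] with the same
    basis, which is how type D reduces to type C. *)
Definition real_basis_for H G : Prop :=
  forall A : 'M[C]_3, A \in unitmx -> G (pgl A) ->
    descends_in (real_complex R) H A.

Lemma definable_real_basis G : definable_over_R G ->
  exists2 H : 'M[C]_3, H \in unitmx & real_basis_for H G.
Proof.
move=> [G' [_ G'R] [h hG]]; have [H uH hE] := pgl_surj h; exists H => // A uA GA.
apply: PGL_conj_descends => //; apply: G'R.
by rewrite -hG -hE; exists (pgl A).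
Qed.

Lemma conjc_real_complex (x : R) : conjc (real_complex R x) = real_complex R x.
Proof. by rewrite /= oppr0. Qed.

Lemma unit_circle_neq0 x : conjc x * x = 1 -> x != 0.
Proof.
by move=> x1; apply/eqP => x0; move: x1; rewrite x0 mulr0 => /esym/eqP; rewrite oner_eq0.
Qed.

Lemma real_diag3 H p q r : H \in unitmx ->
  conjc p * p = 1 -> conjc q * q = 1 -> conjc r * r = 1 ->
  descends_in (real_complex R) H (diag3_mx p q r) ->
  [\/ p ^+ 2 = q * r, q ^+ 2 = p * r | r ^+ 2 = p * q].
Proof.
move=> uH p1 q1 r1 /(descends_in_trace uH)[x].
have -> : \tr (diag3_mx p q r) = p + q + r.
  by rewrite mxtrace_diag !big_ord_recr big_ord0 /= add0r !mxE.
have -> : \det (diag3_mx p q r) = p * q * r.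
  by rewrite det_diag !big_ord_recr big_ord0 /= mul1r !mxE.
exact: (unit_circle_relation (f := conjc)) p1 q1 r1 (conjc_real_complex x).
Qed.

(** T and diag(1,w,w^2) commute in PGL_3, but their matrices commute only up to the
    scalar w, which must then be real. *)
Lemma diag_cube_root_trivial H G w : G T -> H \in unitmx ->
  real_basis_for H G -> conjc w * w = 1 -> w ^+ 3 = 1 ->
  G (diag3 1 w (w ^+ 2)) -> w = 1.
Proof.
move=> GT uH realH w1 w3 Gd; have w0 := unit_circle_neq0 w1.
have rT : descends_in (real_complex R) H mxT := realH _ (T_unit R) GT.
have ud := diag3_unit (oner_neq0 C) w0 (expf_neq0 2 w0).
have rd : descends_in (real_complex R) H (diag3_mx 1 w (w ^+ 2)) := realH _ ud Gd.
have wR : conjc w = w.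
  suff [x ->] : exists x : R, w = real_complex R x by apply: conjc_real_complex.
  apply: descends_in_commutator uH rT rd _.
  rewrite mxT_diag3 scalemxAl -linearZ /=; congr (diag_mx _ *m _).
  apply/rowP => i; rewrite !mxE.
  by case: i => [[|[|[|//]]] ?] /=; rewrite ?mulr1 -?expr2 -?exprS.
by move: w1; rewrite wR => w2; rewrite -w3 !exprS expr0 mulr1 w2 mulr1.
Qed.

(** The trace condition holds for d = diag(1,a,b) and for its quotient by a
    T-conjugate; together they leave only sixth roots of unity, and the cube roots
    among them are excluded by the commutator condition. *)
Lemma real_diag_involution H G a b : is_subgroup G -> G T -> H \in unitmx ->
  real_basis_for H G -> conjc a * a = 1 -> conjc b * b = 1 ->
  G (diag3 1 a b) -> a ^+ 2 = 1 /\ b ^+ 2 = 1.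
Proof.
move=> gG GT uH realH a1 b1 Gd.
have a0 := unit_circle_neq0 a1; have b0 := unit_circle_neq0 b1.
have n0 : 1 != 0 :> C := oner_neq0 _.
have Gd' : G (diag3 b 1 a).
  exact: (diag3_shift gG GT a0 b0 n0 (diag3_shift gG GT n0 a0 b0 Gd)).
have a20 := expf_neq0 2 a0; have b20 := expf_neq0 2 b0.
have Gdd : G (diag3 1 (a ^+ 2) (b ^+ 2)).
  have -> : diag3 1 (a ^+ 2) (b ^+ 2) = (diag3 1%R a b * diag3 1%R a b)%g.
    by rewrite (diag3M n0 a0 b0 n0 a0 b0) mulr1.
  exact: (subgroupM gG Gd Gd).
(* The product of the three T-conjugates of d is scalar, so d^2 times the conjugate
   diag(b,1,a) is the quotient of d by the conjugate diag(a,b,1). *)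
have Gq : G (diag3 b (a ^+ 2) (a * b ^+ 2)).
  have -> : diag3 b (a ^+ 2) (a * b ^+ 2) =
            (diag3 1%R (a ^+ 2)%R (b ^+ 2)%R * diag3 b 1%R a)%g.
    by rewrite (diag3M n0 a20 b20 b0 n0 a0) mul1r mulr1 [a * _]mulrC.
  exact: (subgroupM gG Gdd Gd').
have c1 : conjc 1 * 1 = 1 :> C by rewrite conjc1 mulr1.
have a2 : conjc (a ^+ 2) * a ^+ 2 = 1.
  by rewrite rmorphXn -exprMn a1 expr1n.
have ab2 : conjc (a * b ^+ 2) * (a * b ^+ 2) = 1.
  by rewrite rmorphM rmorphXn mulrACA -exprMn a1 b1 expr1n mulr1.
have rd := real_diag3 uH c1 a1 b1 (realH _ (diag3_unit n0 a0 b0) Gd).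
rewrite expr1n !mul1r in rd.
have uq : diag3_mx b (a ^+ 2) (a * b ^+ 2) \in unitmx.
  exact: (diag3_unit b0 a20 (mulf_neq0 a0 b20)).
have rq := real_diag3 uH b1 a2 ab2 (realH _ uq Gq).
have {rq} cubes : [\/ a ^+ 3 = 1, a ^+ 3 = b ^+ 3 | b ^+ 3 = 1].
  case: rq => e.
  - apply: Or31; apply: (mulfI (expf_neq0 2 b0)).
    by rewrite mulr1 [RHS]e; ring.
  - apply: Or32; apply: (mulfI a0); transitivity ((a ^+ 2) ^+ 2); first by ring.
    by rewrite e; ring.
  - apply: Or33; apply: (mulfI (mulf_neq0 (expf_neq0 2 a0) b0)).
    by rewrite mulr1 [RHS]mulrC -e; ring.
have {rd} [w3 b2] : (a ^+ 2) ^+ 3 = 1 /\ b ^+ 2 = (a ^+ 2) ^+ 2.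
  exact: sixth_roots.
have w1 : a ^+ 2 = 1.
  by rewrite b2 in Gdd; apply: diag_cube_root_trivial GT uH realH a2 w3 Gdd.
by rewrite b2 w1 expr1n.
Qed.

(** * Groups of type C and D *)

Lemma diag3_V4 a b : a ^+ 2 = 1 -> b ^+ 2 = 1 ->
  [\/ diag3 1 a b = 1%g, diag3 1 a b = diag3 1 1 (-1),
    diag3 1 a b = diag3 1 (-1) 1 | diag3 1 a b = diag3 1 (-1) (-1)].
Proof.
move=> /eqP; rewrite sqrf_eq1 => a1 /eqP; rewrite sqrf_eq1 => b1.
case/orP: a1 => /eqP ->; case/orP: b1 => /eqP ->.
- by apply: Or41; rewrite diag3_1.
- exact: Or42.
- exact: Or43.
- exact: Or44.
Qed.

Lemma zeta_unit_circle n (k : int) : conjc (zeta R n ^ k) * zeta R n ^ k = 1.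
Proof.
rewrite fmorphXz -exprzMl ?unitfE ?conjc_eq0 ?zeta_neq0//.
suff -> : conjc (zeta R n) * zeta R n = 1 by rewrite exp1rz.
rewrite /zeta; set t := (2 * pi / n%:R : R); apply/eqP.
rewrite eq_complex /= mulNr opprK -!expr2 cos2Dsin2 eqxx /=.
by rewrite mulNr mulrC subrr.
Qed.

Lemma root_diagP d : @root_diag R d ->
  exists a b, [/\ conjc a * a = 1, conjc b * b = 1 & d = diag3 1 a b].
Proof.
move=> [n [k [l [_ ->]]]]; exists (zeta R n ^ k), (zeta R n ^ l).
by split; rewrite ?zeta_unit_circle.
Qed.

Lemma sigma_elT : sigma T = T.
Proof.
by rewrite /sigma (PGL_map_pgl _ (T_unit R)) conj_mxT.
Qed.

Lemma sigma_elR : sigma (elR R) = elR R.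
Proof.
by rewrite /sigma (PGL_map_pgl _ (R_unit R)) conj_mxR.
Qed.

Lemma sigma_root_diag d : root_diag d -> sigma d = (d^-1)%g.
Proof.
move=> /root_diagP[a [b [a1 b1 ->]]].
have n0 := oner_neq0 C.
have a0 := unit_circle_neq0 a1; have b0 := unit_circle_neq0 b1.
have ca0 : conjc a != 0 by rewrite conjc_eq0.
have cb0 : conjc b != 0 by rewrite conjc_eq0.
apply: (mulIg (diag3 1 a b)).
rewrite mulVg /sigma (PGL_map_pgl _ (diag3_unit n0 a0 b0)) conj_diag3 conjc1.
by rewrite -/(diag3 _ _ _) (diag3M n0 ca0 cb0 n0 a0 b0) mulr1 a1 b1 diag3_1.
Qed.

Lemma sigma_typeC G : typeC G -> @sigma R @` G = G.
Proof.
move=> [_ [D [_ Ddiag ->]]]; apply: image_generated; [exact: sigmaM|exact: sigmaK|].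
move=> _ [g [->|Dg] <-].
  by rewrite sigma_elT; apply: sub_generated; left.
rewrite sigma_root_diag; last exact: Ddiag.
by apply: subgroupV (generated_group _) _; apply: sub_generated; right.
Qed.

Lemma sigma_typeD G : typeD G -> @sigma R @` G = G.
Proof.
move=> [K KC ->]; apply: image_generated; [exact: sigmaM|exact: sigmaK|].
move=> _ [g [->|Kg] <-].
  by rewrite sigma_elR; apply: sub_generated; left.
by apply: sub_generated; right; rewrite -(sigma_typeC KC); exists g.
Qed.

Lemma typeC_group G : typeC G -> is_subgroup G.
Proof. by move=> [_ [D [_ _ ->]]]; apply: generated_group. Qed.

Lemma G12_diag3 : G12 R (diag3 1 1 (-1)) /\ G12 R (diag3 1 (-1) 1).
Proof. by split; apply: sub_generated; [right|left; right]. Qed.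

(** T permutes the three nontrivial diagonal involutions cyclically, so any one of
    them brings in the others. *)
Lemma sub_G12 G : is_subgroup G -> G T ->
  [\/ G (diag3 1 1 (-1)), G (diag3 1 (-1) 1) | G (diag3 1 (-1) (-1))] ->
  G12 R `<=` G.
Proof.
move=> gG GT GV.
have n1 : -1 != 0 :> C by rewrite oppr_eq0 oner_eq0.
have n0 : 1 != 0 :> C := oner_neq0 _.
have shift : G (diag3 1 1 (-1)) <-> G (diag3 1 (-1) 1).
  split=> Gd; first exact: (diag3_shift gG GT n0 n0 n1 Gd).
  exact: (diag3_shift gG GT n1 n0 n0 (diag3_shift gG GT n0 n1 n0 Gd)).
have {GV} Gd : G (diag3 1 1 (-1)).
  case: GV => [Gd|/shift Gd|Gd]; [exact: Gd|exact: Gd|].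
  rewrite -(diag3_scale n1 n0 n0 n1) mulrNN !mulr1.
  exact: (diag3_shift gG GT n0 n1 n1 Gd).
apply: (generated_sub gG) => _ [[->|->]|->]; [exact: GT| |exact: Gd].
exact/shift.
Qed.

Lemma real_typeC H G : H \in unitmx -> real_basis_for H G -> typeC G ->
  G = generated [set T] \/ G = G12 R.
Proof.
move=> uH realH GC; have gG := typeC_group GC.
move: GC => [_ [D [_ Ddiag GE]]].
have GT : G T by rewrite GE; apply: sub_generated; left.
have GD d : D d -> G d by move=> Dd; rewrite GE; apply: sub_generated; right.
have DV d : D d -> [\/ d = 1%g, d = diag3 1 1 (-1),
    d = diag3 1 (-1) 1 | d = diag3 1 (-1) (-1)].
  move=> Dd; have [a [b [a1 b1 dE]]] := root_diagP (Ddiag _ Dd).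
  move: (GD _ Dd); rewrite {}dE => Gd.
  by have [] := real_diag_involution gG GT uH realH a1 b1 Gd; apply: diag3_V4.
have [D1|/existsNP[d /not_implyP[Dd d1]]] := pselect (forall d, D d -> d = 1%g).
  left; rewrite GE; apply: generated_eq => g; last first.
    by move=> ->; apply: sub_generated; left.
  case=> [->|/D1->]; first exact: sub_generated.
  exact: subgroup1 (generated_group _).
right; apply/seteqP; split.
  have g12 : is_subgroup (G12 R) := generated_group _.
  have [V1 V2] := G12_diag3.
  have n1 : -1 != 0 :> C by rewrite oppr_eq0 oner_eq0.
  have n0 : 1 != 0 :> C := oner_neq0 _.
  rewrite {1}GE; apply: (generated_sub g12) => g [->|/DV[]->].
  - by apply: sub_generated; left; left.
  - exact: subgroup1 g12.
  - exact: V1.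
  - exact: V2.
  - have -> : diag3 1 (-1) (-1) = (diag3 1%R 1%R (-1)%R * diag3 1%R (-1)%R 1%R)%g :> PGL C 3.
      by rewrite (diag3M n0 n0 n1 n0 n1 n0) !mul1r mulr1.
    exact: (subgroupM g12 V1 V2).
apply: (sub_G12 gG GT).
case: (DV _ Dd) (GD _ Dd) => [/d1[]|->|->|->] Gd.
- exact: Or31.
- exact: Or32.
- exact: Or33.
Qed.

Lemma definable_generated S : S `<=` PGL3R R -> definable_over_R (generated S).
Proof.
move=> SR; exists (generated S); last exact: conjugate_refl.
split; first exact: generated_group.
exact: (generated_sub PGL3R_group SR).
Qed.

Lemma PGL3R_elT : PGL3R R T.
Proof. exact: (PGL3R_pgl (T_unit R) conj_mxT). Qed.

Lemma PGL3R_elR : PGL3R R (elR R).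
Proof. exact: (PGL3R_pgl (R_unit R) conj_mxR). Qed.

Lemma PGL3R_G12 : G12 R `<=` PGL3R R.
Proof.
apply: sub_G12; [exact: PGL3R_group|exact: PGL3R_elT|apply: Or31].
have n1 : -1 != 0 :> C by rewrite oppr_eq0 oner_eq0.
apply: PGL3R_pgl; first exact: (diag3_unit (oner_neq0 C) (oner_neq0 C) n1).
by rewrite conj_diag3 rmorphN1 conjc1.
Qed.

Lemma pseudo_real_typeC G : typeC G ->
  (pseudo_real G <-> G <> generated [set T] /\ G <> G12 R).
Proof.
move=> GC; split=> [[_ ndef]|[nT n12]].
  split=> GE; apply: ndef; rewrite GE; apply: definable_generated.
    by move=> _ ->; apply: PGL3R_elT.
  exact: subset_trans (@sub_generated _ _) PGL3R_G12.
split; first by rewrite /real_field_of_moduli sigma_typeC//; apply: conjugate_refl.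
by move=> /definable_real_basis[H uH realH]; case: (real_typeC uH realH GC).
Qed.

Lemma pseudo_real_typeD G : typeD G ->
  (pseudo_real G <-> G <> generated [set T; elR R] /\ G <> G24 R).
Proof.
move=> GD; split=> [[_ ndef]|[nT n24]].
  split=> GE; apply: ndef; rewrite GE; apply: definable_generated.
    by move=> _ [->|->]; [apply: PGL3R_elT|apply: PGL3R_elR].
  by move=> g [->|/PGL3R_G12]; first exact: PGL3R_elR.
split; first by rewrite /real_field_of_moduli sigma_typeD//; apply: conjugate_refl.
move: GD nT n24 => [K KC ->] nT n24 /definable_real_basis[H uH realH].
have realHK : real_basis_for H K.
  by move=> A uA KA; apply: realH => //; apply: sub_generated; right.
have [KE|KE] := real_typeC uH realHK KC; last by apply: n24; rewrite KE.
by apply: nT; rewrite KE generatedU_generated setUC.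
Qed.

End PGL3.

Theorem theorem2p6 (R : realType) :
  (forall G : set (PGL R[i] 3), typeC G ->
     (pseudo_real G <-> G <> generated [set elT R] /\ G <> G12 R)) /\
  (forall G : set (PGL R[i] 3), typeD G ->
     (pseudo_real G <-> G <> generated [set elT R; elR R] /\ G <> G24 R)).
Proof.
by split=> G; [apply: pseudo_real_typeC|apply: pseudo_real_typeD].
Qed.
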